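(* Let $m\in\mathbb{N}\setminus\{0,1\}$. For every $n\in\{1,\ldots,m-1\}$ and $i\in\{1,\ldots,n\}$, let $$a_{i,n}=\frac12\sup_{p\in\mathbb{N}}\left(\beta_{i,n,p}^2+\widetilde\beta_{i,n,p}^2+\eta_{i,n}^2+\sqrt{(\beta_{i,n,p}^2+\widetilde\beta_{i,n,p}^2+\eta_{i,n}^2)^2-4\beta_{i,n,p}^2\eta_{i,n}^2}\right),$$ and for $i\in\{1,\ldots,m\}$ let $\overline a_{i,m}=\sup_{p\in\mathbb{N}}(\beta_{i,m,p}^2+\widetilde\beta_{i,m,p}^2)$, where $\eta_n=1$ for every $n$ (no leakage), so that $\eta_{i,n}=1$. Set $\theta_0=1$, $\theta_n=\sum_{i=1}^n\theta_{i-1}\sqrt{a_{i,n}}$ for $n\in\{1,\ldots,m-1\}$, and $\overline\theta_m=\sum_{i=1}^m\theta_{i-1}\sqrt{\overline a_{i,m}}$. Let $\alpha\in[1/2,1]$, $\gamma_\alpha=2^m(1-\alpha)$, and $$\overline b_\alpha=\frac12\sup_{p\in\mathbb{N}}\left((\beta_{1,m,p}-\gamma_\alpha)^2+\widetilde\beta_{1,m,p}^2+\gamma_\alpha^2+\sqrt{\big((\beta_{1,m,p}-\gamma_\alpha)^2+\widetilde\beta_{1,m,p}^2+\gamma_\alpha^2\big)^2-4(\beta_{1,m,p}-\gamma_\alpha)^2\gamma_\alpha^2}\right).$$ If $$\sqrt{\overline b_\alpha}-\sqrt{\overline a_{1,m}}\le 2^m\alpha-2\overline\theta_m,$$ then the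 network with input $(x_0,b_0)\in\mathcal{X}\times\mathcal{X}$ and output $(x_m,0)\in\mathcal{X}\times\mathcal{X}$, where $x_n=R_n(W_nx_{n-1}+V_nb_0)$ for $n\in\{1,\ldots,m\}$ with $V_n=\lambda_n\mathrm{Id}$, is $\alpha$-averaged.
   Context: $\mathcal{X},\mathcal{Y}$ are Hilbert spaces of functions on $]0,1[$ (typically $L^2(0,1)$); $T:\mathcal{X}\to\mathcal{Y}$ is the compact linear integral operator $(Tx)(t)=\int_0^1 k(t,s)x(s)\,ds$ with $k\in L^2([0,1]^2)$; $D$ is a linear regularization operator of derivative type; $^*$ denotes the adjoint. It is assumed that $T^*T$ and $D^*D$ commute and are diagonalized in the same orthonormal set of eigenvectors $(v_p)_{p\in\mathbb{N}}$, with eigenvalues $(\beta_{T,p})_p$ and $(\beta_{D,p})_p$ respectively. $g:\mathcal{X}\to\,]-\infty,+\infty]$ is proper, lower semicontinuous and convex. For $n\in\{1,\ldots,m\}$, $\lambda_n,\mu_n,\tau_n$ are positive reals. $\mathrm{Id}$ is the identity operator. The proximity operator is $\mathrm{prox}_{f}(x)=\operatorname{argmin}_{y\in\mathcal{X}}\,(f(y)+\frac12\|x-y\|^2)$. $\mathcal{X}\times\mathcal{X}$ carries the norm $\|(x,b)\|=\sqrt{\|x\|^2+\|b\|^2}$. The layers of the network are given by $R_n=\mathrm{prox}_{\lambda_n\mu_ng}$, $W_n=\mathrm{Id}-\lambda_nT^*T-\lambda_n\tau_nD^*D$, $V_n=\lambda_n\mathrm{Id}$. (In the underlying inverse problem $b_0=T^*y^\delta$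 for observed data $y^\delta$; here $b_0$ is regarded as an input.) For $1\le i\le n\le m$ and $p\in\mathbb{N}$: $\beta_p^{(n)}=1-\lambda_n(\beta_{T,p}+\tau_n\beta_{D,p})$; $\beta_{i,n,p}=\prod_{j=i}^n\beta_p^{(j)}$; $\eta_{i,j}=\eta_j\cdots\eta_i$ if $j\ge i$ and $\eta_{i,j}=1$ otherwise (all equal to $1$ here, since $\eta_n=1$ for every $n$); $\widetilde\beta_{i,n,p}=\sum_{j=i}^{n-1}\beta_p^{(n)}\cdots\beta_p^{(j+1)}\lambda_j\eta_{i,j-1}+\lambda_n\eta_{i,n-1}$ (an empty sum is $0$), that is, $\widetilde\beta_{i,n,p}=\sum_{j=i}^{n-1}\beta_p^{(n)}\cdots\beta_p^{(j+1)}\lambda_j+\lambda_n$. An operator $S:\mathcal{H}\to\mathcal{H}$ on a Hilbert space is $\alpha$-averaged if $S=(1-\alpha)\mathrm{Id}+\alpha R$ for some nonexpansive (1-Lipschitz) operator $R:\mathcal{H}\to\mathcal{H}$ (for $\alpha=1$ this means that $S$ is nonexpansive). *)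

(* Defs.v *)
From HB Require Import structures.
From mathcomp Require Import all_boot all_order all_algebra.
From mathcomp Require Import all_classical all_reals all_analysis.

Set Implicit Arguments.
Unset Strict Implicit.
Unset Printing Implicit Defensive.

Import Order.TTheory GRing.Theory Num.Theory.
Import numFieldNormedType.Exports.

Local Open Scope classical_set_scope.
Local Open Scope ring_scope.

(* A real Hilbert space is a complete normed module together with a symmetric
   positive definite bilinear form inducing its norm. *)
Definition hilbert_dot (R : realType) (X : completeNormedModType R)
    (d : {dot X for idfun}) : Prop :=
  forall x : X, d x x = `|x| ^+ 2.

(* ev x is a representative of the class, modulo a.e. equality, of functions
   on ]0,1[ that the vector x stands for; the last clause says that the class
   determines x. *)
Definition function_space (R : realType) (X : lmodType R) (ev : X -> R -> R) :
    Prop :=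
  [/\ forall x : X, measurable_fun (`]0, 1[ : set R) (ev x),
      forall (c : R) (x y : X),
        {ae @lebesgue_measure R, forall t : R, t \in `]0, 1[ ->
          ev (c *: x + y) t = c * ev x t + ev y t} &
      forall x : X,
        {ae @lebesgue_measure R, forall t : R, t \in `]0, 1[ -> ev x t = 0} ->
        x = 0].

Definition L2_kernel (R : realType) (k : R * R -> R) : Prop :=
  let I2 := (`[0, 1] `*` `[0, 1] : set (R * R)) in
  measurable_fun I2 k /\
  ((@lebesgue_measure R) \x (@lebesgue_measure R))%E.-integrable I2
    (fun u => (k u ^+ 2)%:E).

Definition integral_operator (R : realType) (X Y : lmodType R)
    (evX : X -> R -> R) (evY : Y -> R -> R) (k : R * R -> R) (T : X -> Y) :
    Prop :=
  forall x : X, {ae @lebesgue_measure R, forall t : R, t \in `]0, 1[ ->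
    (@lebesgue_measure R).-integrable `]0, 1[ (fun s => (k (t, s) * evX x s)%:E) /\
    evY (T x) t = \int[@lebesgue_measure R]_(s in `]0, 1[) (k (t, s) * evX x s)}.

Definition compact_operator (R : realType) (X Y : normedModType R)
    (T : X -> Y) : Prop :=
  forall A : set X, bounded_set A -> precompact (T @` A).

Definition is_adjoint (R : realType) (X Y : lmodType R)
    (dX : {dot X for idfun}) (dY : {dot Y for idfun})
    (T : X -> Y) (Tstar : Y -> X) : Prop :=
  forall (x : X) (y : Y), dY (T x) y = dX x (Tstar y).

Definition orthonormal_basis (R : realType) (X : normedModType R)
    (d : {dot X for idfun}) (v : nat -> X) : Prop :=
  (forall p q : nat, d (v p) (v q) = (p == q)%:R) /\
  (forall x : X, series (fun p => d x (v p) *: v p) @ \oo --> x).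

Definition proper_fun (R : realType) (X : Type) (g : X -> \bar R) : Prop :=
  (forall x, g x != -oo%E) /\ (exists x, g x != +oo%E).

Definition convex_efun (R : realType) (X : lmodType R) (g : X -> \bar R) :
    Prop :=
  forall (x y : X) (t : R), 0 < t < 1 ->
    (g (t *: x + (1 - t) *: y)%R <= t%:E * g x + (1 - t)%:E * g y)%E.

Definition argmin (R : realType) (X : Type) (f : X -> \bar R) : set X :=
  [set p | forall y, (f p <= f y)%E].

(* The minimizer exists and is unique when f is proper, lower semicontinuous
   and convex on a Hilbert space; xget is only junk-valued otherwise. *)
Definition prox (R : realType) (X : normedModType R) (f : X -> \bar R)
    (x : X) : X :=
  xget 0 (argmin (fun y => (f y + (2^-1 * `|x - y| ^+ 2)%:E)%E)).

(* The norm N is explicit because the library norm on a product is the max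
   norm. *)
Definition nonexpansive (R : realType) (H : lmodType R) (N : H -> R)
    (Q : H -> H) : Prop :=
  forall u w : H, N (Q u - Q w) <= N (u - w).

Definition averaged (R : realType) (H : lmodType R) (N : H -> R) (alpha : R)
    (S : H -> H) : Prop :=
  exists Q : H -> H, nonexpansive N Q /\
    forall u : H, S u = (1 - alpha) *: u + alpha *: Q u.

Definition prod_norm (R : realType) (X : normedModType R) (u : X * X) : R :=
  Num.sqrt (`|u.1| ^+ 2 + `|u.2| ^+ 2).

Section coefficients.
Context {R : realType}.
Variables (betaT betaD lam tau eta : nat -> R).

Definition beta_layer (n p : nat) : R := 1 - lam n * (betaT p + tau n * betaD p).

Definition beta_prod (i n p : nat) : R := \prod_(i <= j < n.+1) beta_layer j p.

Definition eta_prod (i j : nat) : R := \prod_(i <= k < j.+1) eta k.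

Definition tbeta (i n p : nat) : R :=
  \sum_(i <= j < n)
     (\prod_(j.+1 <= k < n.+1) beta_layer k p) * lam j * eta_prod i j.-1
  + lam n * eta_prod i n.-1.

(* The suprema below are real-valued; the sets are bounded as soon as the
   eigenvalue sequences betaT and betaD are. *)

Definition a_coef (i n : nat) : R :=
  2^-1 * sup (range (fun p : nat =>
    let s := beta_prod i n p ^+ 2 + tbeta i n p ^+ 2 + eta_prod i n ^+ 2 in
    s + Num.sqrt (s ^+ 2 - 4 * beta_prod i n p ^+ 2 * eta_prod i n ^+ 2))).

Definition abar_coef (i m : nat) : R :=
  sup (range (fun p : nat => beta_prod i m p ^+ 2 + tbeta i m p ^+ 2)).

Definition gamma_coef (m : nat) (alpha : R) : R := 2 ^+ m * (1 - alpha).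

Definition bbar_coef (m : nat) (alpha : R) : R :=
  2^-1 * sup (range (fun p : nat =>
    let c := gamma_coef m alpha in
    let s := (beta_prod 1%N m p - c) ^+ 2 + tbeta 1%N m p ^+ 2 + c ^+ 2 in
    s + Num.sqrt (s ^+ 2 - 4 * (beta_prod 1%N m p - c) ^+ 2 * c ^+ 2))).

End coefficients.

Section network.
Context {R : realType} {X Z Y : normedModType R}.
Variables (T : X -> Y) (Tstar : Y -> X) (D : X -> Z) (Dstar : Z -> X).
Variables (g : X -> \bar R) (lam mu tau : nat -> R).

Definition Rlayer (n : nat) : X -> X :=
  prox (fun y => ((lam n * mu n)%:E * g y)%E).

Definition Wlayer (n : nat) (x : X) : X :=
  x - lam n *: Tstar (T x) - (lam n * tau n) *: Dstar (D x).

Definition Vlayer (n : nat) (b : X) : X := lam n *: b.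

Fixpoint net_state (n : nat) (x0 b0 : X) : X :=
  if n is n'.+1
  then Rlayer n (Wlayer n (net_state n' x0 b0) + Vlayer n b0)
  else x0.

Definition network (m : nat) (u : X * X) : X * X := (net_state m u.1 u.2, 0).

End network.

(* Main.v *)
Require Import Defs.
From HB Require Import structures.
From mathcomp Require Import all_boot all_order all_algebra.
From mathcomp Require Import all_classical all_reals all_analysis.
From mathcomp Require Import ring lra.

Set Implicit Arguments.
Unset Strict Implicit.
Unset Printing Implicit Defensive.

Import Order.TTheory GRing.Theory Num.Theory.
Import numFieldNormedType.Exports.

Local Open Scope classical_set_scope.
Local Open Scope ring_scope.

(** Put the network on [X * X]: layer [n] maps [(x, b)] to
    [(R_n (W_n x + lam_n b), e_n b)] with [e_n = 1] for [n < m] and [e_m = 0].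
    Since each [R_n] is a proximity operator, [2 R_n - Id] is nonexpansive, so
    the difference [delta_n] of two trajectories satisfies
    [2 delta_n = L_n delta_(n-1) + q_n], where [L_n] is the linear part of the
    layer and [|q_n| <= |L_n delta_(n-1)|].  Unfolding,
    [2^m delta_m = sum_(j <= m) L_m ... L_(j+1) r_j] with [r_0 = delta_0] and
    [r_j = 2^(j-1) q_j], and induction gives [|r_j| <= theta_j |delta_0|].  The
    triangle inequality for [2^m delta_m - 2^m (1 - alpha) delta_0] then turns
    the hypothesis into [|delta_m - (1 - alpha) delta_0| <= alpha |delta_0|],
    which is averagedness.  The norms of the products [L_n ... L_i] come from
    Parseval's identity: in the coordinates along [v_p] such a product is the
    2x2 matrix [[beta, tbeta], [0, e_n]].  The suprema are finite because an
    everywhere defined operator with an adjoint is bounded. *)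

Definition bounded_seq (R : realType) (f : nat -> R) : Prop :=
  exists M : R, forall p, `|f p| <= M.

(** * Real Hilbert spaces: Cauchy-Schwarz and Parseval *)

Section hilbert_space.
Context {R : realType} {X : completeNormedModType R} (d : {dot X for idfun}).
Hypothesis hd : hilbert_dot d.

Lemma dotC (x y : X) : d x y = d y x.
Proof. by rewrite hermC expr0 mul1r. Qed.

Lemma dotZl (c : R) (x y : X) : d (c *: x) y = c * d x y.
Proof. by rewrite linearZl_LR. Qed.

Lemma dotZr (c : R) (x y : X) : d x (c *: y) = c * d x y.
Proof. by rewrite dotC dotZl dotC. Qed.

Lemma normD_sqr (x y : X) :
  `|x + y| ^+ 2 = `|x| ^+ 2 + 2 * d x y + `|y| ^+ 2.
Proof. by rewrite -!hd linearDl 2!linearDr/= (dotC y x); ring. Qed.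

Lemma normB_sqr (x y : X) :
  `|x - y| ^+ 2 = `|x| ^+ 2 - 2 * d x y + `|y| ^+ 2.
Proof. by rewrite normD_sqr linearNr/= normrN mulrN. Qed.

Lemma dot_norm_le (x y : X) : `|d x y| <= `|x| * `|y|.
Proof.
have [->|y0] := eqVneq y 0; first by rewrite linear0r normr0 mulr_ge0.
have y_gt0 : 0 < `|y| ^+ 2 by rewrite exprn_gt0// normr_gt0.
rewrite -ler_sqr ?nnegrE ?mulr_ge0// exprMn real_normK ?num_real//.
have : 0 <= `|(`|y| ^+ 2) *: x - d x y *: y| ^+ 2 by rewrite sqr_ge0.
rewrite normB_sqr dotZl dotZr !normrZ !exprMn !real_normK ?num_real//.
rewrite [X in 0 <= X](_ : _ =
  `|y| ^+ 2 * (`|x| ^+ 2 * `|y| ^+ 2 - d x y ^+ 2)); last by ring.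
by rewrite pmulr_rge0// subr_ge0.
Qed.

Lemma dot_eq0 (x : X) : (forall z, d z x = 0) -> x = 0.
Proof.
by move=> x0; apply/eqP; rewrite -normr_eq0 -sqrf_eq0 -hd x0.
Qed.

(** Pairing [x] with the remainder of its expansion gives |x|^2 minus the partial sum of squared
    coordinates. Cauchy-Schwarz then makes this difference as small as the remainder. *)
Lemma parseval (v : nat -> X) (x : X) : orthonormal_basis d v ->
  (\sum_(p < n) d x (v p) ^+ 2) @[n --> \oo] --> `|x| ^+ 2.
Proof.
move=> [_ vx]; apply/cvgrPdist_le => e e0.
have e'0 : 0 < e / (`|x| + 1) by rewrite divr_gt0// ltr_wpDl.
have /cvgrPdist_le/(_ _ e'0) := vx x.
apply: filterS => n /= xn.
have -> : `|x| ^+ 2 - \sum_(p < n) d x (v p) ^+ 2 =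
    d x (x - series (fun p => d x (v p) *: v p) n).
  rewrite linearBr/= hd; congr (_ - _).
  rewrite /series/= big_mkord linear_sumr; apply: eq_bigr => p _.
  by rewrite /= dotZr expr2.
rewrite (le_trans (dot_norm_le _ _))//.
rewrite (@le_trans _ _ (`|x| * (e / (`|x| + 1))))//; first exact: ler_wpM2l.
rewrite mulrCA ger_pMr// ler_pdivrMr ?ltr_wpDl// mul1r lerDl//.
Qed.

End hilbert_space.

(** * Operators with an adjoint: boundedness and eigenvalues *)

(* Hellinger-Toeplitz: the functionals [d1 ^~ (Astar y)], [|y| <= 1], are
   pointwise bounded by [|A x|], hence uniformly bounded. *)
Lemma adjoint_bounded (R : realType) (X Y : completeNormedModType R)
    (d1 : {dot X for idfun}) (d2 : {dot Y for idfun})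
    (A : {linear X -> Y}) (Astar : Y -> X) :
  hilbert_dot d1 -> hilbert_dot d2 -> is_adjoint d1 d2 A Astar ->
  exists M : R, forall x, `|x| <= 1 -> `|A x| <= M.
Proof.
move=> h1 h2 adj.
pose F := [set f : X -> R^o |
  exists2 y : Y, `|y| <= 1 & f = (fun x => d1 x (Astar y))].
have [f Ff|x|M MF] := @Banach_Steinhauss R X R^o F _ _ 1.
- case: Ff => y y1 ->; split.
  + move=> r; exists (r * `|Astar y|) => x xr.
    by rewrite (le_trans (dot_norm_le h1 _ _))// ler_wpM2r.
  + by move=> c x z; rewrite linearPl.
- exists `|A x| => f [y y1 ->]; rewrite -adj.
  by rewrite (le_trans (dot_norm_le h2 _ _))// ler_piMr.
exists M => x x1.
have [->|Ax0] := eqVneq (A x) 0.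
  rewrite normr0; have := MF (fun x => d1 x (Astar 0)).
  by move=> /(_ _ x x1)/(le_trans _); apply => //; exists 0; rewrite ?normr0.
have nA : 0 < `|A x| by rewrite normr_gt0.
(* The unit vector along [A x] attains the norm: [d1 x (Astar y)] equals |A x|. *)
pose y := `|A x|^-1 *: A x.
have y1 : `|y| = 1 by rewrite normrZ normfV normr_id mulVf// gt_eqF.
have := MF (fun x => d1 x (Astar y)) (ex_intro2 _ _ y _ erefl) x x1.
rewrite y1 -adj (dotZr d2) h2 expr2 mulKf ?gt_eqF// normr_id; exact.
Qed.

Section adjoint_square.
Context {R : realType} {X Y : completeNormedModType R}.
Variables (d1 : {dot X for idfun}) (d2 : {dot Y for idfun}).
Variables (A : {linear X -> Y}) (Astar : Y -> X).
Hypotheses (h1 : hilbert_dot d1) (adj : is_adjoint d1 d2 A Astar).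

Lemma adjoint_is_linear : linear Astar.
Proof.
move=> c x y; apply/eqP; rewrite -subr_eq0; apply/eqP/(dot_eq0 h1) => z.
rewrite linearBr linearDr/= (dotZr d1) -!adj.
by rewrite linearDr/= (dotZr d2) subrr.
Qed.

Lemma adjoint_eigen (v : X) (b : R) (x : X) :
  Astar (A v) = b *: v -> d1 (Astar (A x)) v = b * d1 x v.
Proof.
by move=> Av; rewrite dotC -adj (dotC d2) adj Av (dotZr d1).
Qed.

End adjoint_square.

(** Since [v p] is a unit vector, the eigenvalue [b p] equals |A (v p)|^2, which the operator bound
    controls uniformly in [p]. *)
Lemma adjoint_eigen_bounded (R : realType) (X Y : completeNormedModType R)
    (d1 : {dot X for idfun}) (d2 : {dot Y for idfun})
    (A : {linear X -> Y}) (Astar : Y -> X) (v : nat -> X) (b : nat -> R) :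
  hilbert_dot d1 -> hilbert_dot d2 -> is_adjoint d1 d2 A Astar ->
  (forall p q, d1 (v p) (v q) = (p == q)%:R) ->
  (forall p, Astar (A (v p)) = b p *: v p) ->
  bounded_seq b.
Proof.
move=> h1 h2 adj von eig.
have [M MA] := adjoint_bounded h1 h2 adj.
exists (M ^+ 2) => p.
have -> : b p = `|A (v p)| ^+ 2.
  by rewrite -h2 adj eig dotZr von eqxx mulr1.
rewrite ger0_norm ?sqr_ge0// lerXn2r ?nnegrE//.
  by rewrite (le_trans _ (MA 0 _))// normr0.
apply: MA; rewrite -(@ler_pXn2r _ 2)// ?nnegrE// expr1n.
by rewrite -h1 von eqxx.
Qed.

(** * Proximity operators: existence of the minimizer and nonexpansive reflection *)

Section proximity_operator.
Context {R : realType} {X : completeNormedModType R} (d : {dot X for idfun}).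
Variables (g : X -> \bar R) (c : R).
Hypotheses (hd : hilbert_dot d) (gproper : proper_fun g).
Hypotheses (glsc : lower_semicontinuous g) (gconvex : convex_efun g).
Hypothesis c_gt0 : 0 < c.

(** Off the effective domain a proper [g] equals +oo, so minimization can be carried out in the
    reals with [h] on [dom]. *)
Let dom : set X := [set y | g y \is a fin_num].
Let h (y : X) : R := fine (g y).

Lemma dom_nonempty : exists x0, dom x0.
Proof.
by have [gNy [x0 gx0]] := gproper; exists x0; rewrite /dom/= fin_numE gNy gx0.
Qed.

Lemma dom_convex (y z : X) (t : R) : dom y -> dom z -> 0 < t < 1 ->
  dom (t *: y + (1 - t) *: z) /\
  h (t *: y + (1 - t) *: z) <= t * h y + (1 - t) * h z.
Proof.
move=> dy dz t01; have := gconvex y z t01.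
rewrite -(fineK dy) -(fineK dz) -!EFinM -EFinD => le.
have dyz : dom (t *: y + (1 - t) *: z).
  rewrite /dom/= fin_numE gproper.1/= -ltey.
  by rewrite (le_lt_trans le)// ltry.
by split=> //; rewrite -lee_fin /h (fineK dyz).
Qed.

(* Near a point of its domain, [g] is bounded below by semicontinuity; convexity
   along the segments through that point propagates this to a bound of linear
   growth. *)
Lemma linear_minorant : exists (x0 : X) (a K : R),
  [/\ dom x0, 0 <= K & forall y, dom y -> a - K * `|y - x0| <= h y].
Proof.
have [x0 dx0] := dom_nonempty.
have lt0 : ((h x0 - 1)%:E < g x0)%E.
  by rewrite -(fineK dx0) lte_fin ltrBlDr ltrDl.
have [V /nbhs_ballP[r /= r0 rV] Vg] := glsc lt0.
exists x0, (h x0 - 1), (2 / r); split=> // [|y dy].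
  by rewrite divr_ge0// ltW.
have [yr|ry] := ltP `|x0 - y| r.
  have /Vg : V y by apply: rV; rewrite -ball_normE.
  rewrite -(fineK dy) lte_fin => /ltW; apply: le_trans.
  by rewrite lerBlDr lerDl mulr_ge0// divr_ge0// ltW.
rewrite distrC in ry.
have n0 : 0 < `|y - x0| by exact: lt_le_trans ry.
(* This [t] puts the convex combination at distance r/2 from [x0], inside the ball where [g] exceeds
   h x0 - 1; the slope 2/r comes from dividing by [t]. *)
pose t := r / (2 * `|y - x0|).
have t0 : 0 < t by rewrite divr_gt0// mulr_gt0.
have t1 : t < 1 by rewrite ltr_pdivrMr ?mulr_gt0// mul1r; lra.
have t01 : 0 < t < 1 by rewrite t0.
have [dz hz] := dom_convex dy dx0 t01.
have /Vg : V (t *: y + (1 - t) *: x0).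
  apply: rV; rewrite -ball_normE/=.
  have -> : x0 - (t *: y + (1 - t) *: x0) = (- t) *: (y - x0).
    rewrite scaleNr scalerBr scalerBl scale1r opprD !opprB addrC -addrA subrK.
    by rewrite addrC.
  rewrite normrZ normrN gtr0_norm//.
  have -> : t * `|y - x0| = r / 2 by rewrite /t; field; rewrite gt_eqF.
  lra.
rewrite -(fineK dz) lte_fin -/(h _) => hz'.
have tE : t * (2 / r * `|y - x0|) = 1.
  by rewrite /t; field; rewrite !gt_eqF.
rewrite -(ler_pM2l t0); nra.
Qed.

Lemma prox_objective_min (x : X) : exists2 p : X, dom p &
  forall y, dom y ->
    c * h p + 2^-1 * `|x - p| ^+ 2 <= c * h y + 2^-1 * `|x - y| ^+ 2.
Proof.
pose F y := c * h y + 2^-1 * `|x - y| ^+ 2.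
have [x0 [a [K [dx0 K0 hK]]]] := linear_minorant.
(* Coercivity: the quadratic term absorbs the linear minorant, and the constant comes from
   completing the square (|x - y| - c K)^2. *)
have F_lb y : dom y ->
    c * a - c * K * `|x - x0| - 2^-1 * (c * K) ^+ 2 <= F y.
  move=> dy; rewrite /F.
  have tri : `|y - x0| <= `|x - y| + `|x - x0|.
    by rewrite (distrC x y); exact: ler_distD.
  have := ler_wpM2l (ltW c_gt0) (hK _ dy).
  have := ler_wpM2l (mulr_ge0 (ltW c_gt0) K0) tri.
  have := sqr_ge0 (`|x - y| - c * K); nra.
pose E := [set F y | y in dom].
have hasE : has_inf E.
  split; first by exists (F x0), x0.
  exists (c * a - c * K * `|x - x0| - 2^-1 * (c * K) ^+ 2).
  by move=> _ [y dy <-]; exact: F_lb.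
have infE y : dom y -> inf E <= F y.
  by move=> dy; apply: ge_inf; [exact: hasE.2|exists y].
have /choice[y_ Hy_] (n : nat) : exists y, dom y /\ F y < inf E + n.+1%:R^-1.
  have n0 : 0 < n.+1%:R^-1 :> R by rewrite invr_gt0.
  by have [_ [y dy <-] Fy] := inf_adherent n0 hasE; exists y.
(* The parallelogram identity makes the objective strongly convex, so that a
   minimizing sequence is Cauchy. *)
have ydist (n k : nat) :
    `|y_ n - y_ k| ^+ 2 <= 4 * (n.+1%:R^-1 + k.+1%:R^-1).
  have [dn Fn] := Hy_ n; have [dk Fk] := Hy_ k.
  have half01 : 0 < (2^-1 : R) < 1 by apply/andP; split; lra.
  have [dm hm] := dom_convex dn dk half01.
  have := infE _ dm; rewrite /F.
  have halfB : 1 - 2^-1 = 2^-1 :> R by lra.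
  rewrite halfB in hm *; set z := 2^-1 *: _ + _ in hm *.
  have xz : `|x - z| ^+ 2 = 2^-1 * `|x - y_ n| ^+ 2 + 2^-1 * `|x - y_ k| ^+ 2
      - 4^-1 * `|y_ n - y_ k| ^+ 2.
    have -> : x - z = 2^-1 *: ((x - y_ n) + (x - y_ k)).
      rewrite addrACA -opprD scalerBr (scalerDr _ (y_ n)); congr (_ - _).
      by rewrite scalerDr -scalerDl (_ : 2^-1 + 2^-1 = 1) ?scale1r//; lra.
    have -> : y_ n - y_ k = (x - y_ k) - (x - y_ n).
      by rewrite opprB [RHS]addrC addrA subrK.
    rewrite normrZ exprMn ger0_norm// (normD_sqr hd (x - y_ n))
      (normB_sqr hd (x - y_ k)).
    by rewrite (dotC d (x - y_ k)); field.
  rewrite xz; move: Fn Fk; rewrite /F.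
  move: (ler_wpM2l (ltW c_gt0) hm) => /=.
  move: (n.+1%:R^-1) (k.+1%:R^-1) => en ek. lra.
have y_cvg : cvg (y_ @ \oo).
  apply/cauchy_cvgP/cauchy_exP => e /= e0.
  have [N N0 NE] : \forall k \near \oo, (k.+1%:R^-1 : R) < e ^+ 2 / 8.
    have e'0 : 0 < e ^+ 2 / 8 by rewrite divr_gt0// exprn_gt0.
    exact: (near_infty_natSinv_lt (PosNum e'0)).
  exists (y_ N), N => // n /= Nn; rewrite -ball_normE/=.
  rewrite -(@ltr_pXn2r _ 2)// ?nnegrE// ?ltW//.
  rewrite (le_lt_trans (ydist _ _))//.
  have := NE _ Nn; have := NE _ (leqnn N).
  move: (n.+1%:R^-1) (N.+1%:R^-1) => en eN; lra.
pose p := lim (y_ @ \oo).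
(* Lower semicontinuity at the limit: otherwise some real [b] above this bound would eventually lie
   below g (y_ n), and letting n grow in F (y_ n) < inf E + 1/(n+1) would contradict the choice of
   [b]. *)
have gp : (g p <= ((inf E - 2^-1 * `|x - p| ^+ 2) / c)%:E)%E.
  rewrite leNgt; apply/negP => gp.
  have [b Bb bg] : exists2 b : R,
      (inf E - 2^-1 * `|x - p| ^+ 2) / c < b & (b%:E < g p)%E.
    move: gp; case: (g p) => [r| |] //.
      rewrite lte_fin => gp; exists ((r + (inf E - 2^-1 * `|x - p| ^+ 2) / c) / 2).
        lra.
      rewrite lte_fin; lra.
    by move=> _; exists ((inf E - 2^-1 * `|x - p| ^+ 2) / c + 1);
      rewrite ?ltry// ltrDl.
  have [V Vp Vg] := glsc bg.
  have Vy : \forall n \near \oo, V (y_ n) by exact: y_cvg.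
  have : c * b <= inf E - 2^-1 * `|x - p| ^+ 2.
    have xy : `|x - y_ n| @[n --> \oo] --> `|x - p|.
      by apply: cvg_norm; apply: cvgB => //; exact: cvg_cst.
    have lim_n : inf E + harmonic n - 2^-1 * (`|x - y_ n| * `|x - y_ n|)
        @[n --> \oo] --> inf E + 0 - 2^-1 * (`|x - p| * `|x - p|).
      apply: cvgB; first by apply: cvgD; [exact: cvg_cst|exact: cvg_harmonic].
      by apply: cvgM; [exact: cvg_cst|exact: cvgM].
    rewrite addr0 -expr2 in lim_n; apply: (cvgr_to_ge lim_n).
    apply: filterS Vy => n /Vg; have [dn] := Hy_ n.
    rewrite -(fineK dn) lte_fin -/(h _) /F /harmonic/= => Fn hb.
    have := ltr_pM2l c_gt0 b (h (y_ n)); rewrite hb.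
    move: (n.+1%:R^-1) Fn => en; lra.
  by rewrite leNgt -ltr_pdivrMl// mulrC Bb.
have dp : dom p.
  by rewrite /dom/= fin_numE gproper.1/= -ltey (le_lt_trans gp)// ltry.
exists p => // y dy; apply: le_trans (infE _ dy).
move: gp; rewrite -(fineK dp) lee_fin ler_pdivlMr// -/(h _); lra.
Qed.

(** This says that (x - p) / c is a subgradient of [g] at [p]. It follows by testing minimality at t
    y + (1 - t) p for small [t]. *)
Lemma prox_variational (x p y : X) :
  dom p -> dom y ->
  (forall y, dom y ->
    c * h p + 2^-1 * `|x - p| ^+ 2 <= c * h y + 2^-1 * `|x - y| ^+ 2) ->
  d (x - p) (y - p) <= c * h y - c * h p.
Proof.
move=> dp dy pmin; rewrite -subr_le0.
set S := d _ _ - _; apply/ler_addgt0Pr => e e0; rewrite add0r.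
(* Minimality leaves an error of t/2 times |y - p|^2; this [t] lies in ]0,1[ and keeps the error
   below [e]. *)
pose t := e / (e + `|y - p| ^+ 2 + 1).
have n0 : 0 <= `|y - p| ^+ 2 by exact: sqr_ge0.
have D0 : 0 < e + `|y - p| ^+ 2 + 1 by lra.
have t0 : 0 < t by rewrite divr_gt0.
have tD : t * (e + `|y - p| ^+ 2 + 1) = e by rewrite /t divfK ?gt_eqF.
have t1 : t < 1 by rewrite /t ltr_pdivrMr// mul1r; lra.
have t01 : 0 < t < 1 by rewrite t0.
have [dm hm] := dom_convex dy dp t01.
have := pmin _ dm.
have -> : x - (t *: y + (1 - t) *: p) = (x - p) - t *: (y - p).
  rewrite scalerBl scale1r scalerBr opprD !opprB -addrA.
  by congr (x + _); rewrite addrC addrAC [in RHS]addrC.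
rewrite (normB_sqr hd (x - p)) dotZr normrZ gtr0_norm// exprMn => le.
have := ler_wpM2l (ltW c_gt0) hm => hm'.
rewrite -(ler_pM2l t0) /S; nra.
Qed.

Lemma argmin_dom (x p : X) :
  argmin (fun y => (c%:E * g y + (2^-1 * `|x - y| ^+ 2)%:E)%E) p <->
  dom p /\ forall y, dom y ->
    c * h p + 2^-1 * `|x - p| ^+ 2 <= c * h y + 2^-1 * `|x - y| ^+ 2.
Proof.
have [x0 dx0] := dom_nonempty.
split=> [pmin|[dp pmin] y].
  have dp : dom p.
    rewrite /dom/= fin_numE gproper.1/=; apply/negP => /eqP gp.
    have := pmin x0; rewrite /= gp gt0_muley ?lte_fin// addye//.
    by rewrite -(fineK dx0) -EFinM -EFinD leye_eq.
  split=> // y dy; have := pmin y.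
  by rewrite /= -(fineK dp) -(fineK dy) -!EFinM -!EFinD lee_fin.
have [dy|dy] := pselect (dom y).
  rewrite -(fineK dp) -(fineK dy) -!EFinM -!EFinD lee_fin; exact: pmin.
have -> : g y = +oo%E.
  apply/eqP/negPn/negP => gy; apply: dy.
  by rewrite /dom/= fin_numE gproper.1 gy.
by rewrite gt0_muley ?lte_fin// addye// leey.
Qed.

(** Adding the variational inequalities at the two proximal points p, q gives firm nonexpansiveness,
    |p - q|^2 <= d (p - q) (x - y); expanding the square of the left-hand side concludes. *)
Lemma reflected_prox_nonexpansive (f := fun y => (c%:E * g y)%E) (x y : X) :
  `|2 *: (prox f x - prox f y) - (x - y)| <= `|x - y|.
Proof.
(* Existence of a minimizer ensures that [xget] returns one rather than its default value 0. *)
have proxP z := xgetPex 0 (let: ex_intro2 p dp pmin := prox_objective_min z in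
  ex_intro _ p (iffRL (argmin_dom z p) (conj dp pmin))).
have [dp pmin] := iffLR (argmin_dom _ _) (proxP x).
have [dq qmin] := iffLR (argmin_dom _ _) (proxP y).
rewrite -/(prox f x) in dp pmin; rewrite -/(prox f y) in dq qmin.
have := prox_variational dp dq pmin; have := prox_variational dq dp qmin.
move: (prox f x) (prox f y) => p q; rewrite -(opprB p q) linearNr/= => hq hp.
rewrite -(@ler_pXn2r _ 2)// ?nnegrE// (normB_sqr hd (2 *: (p - q))).
rewrite normrZ dotZl exprMn ger0_norm//.
have : `|p - q| ^+ 2 - d (p - q) (x - y) <= 0.
  rewrite -hd -linearBr/=.
  have -> : p - q - (x - y) = (y - q) - (x - p).
    by rewrite !opprB addrACA [RHS]addrACA (addrC p).
  by rewrite dotC linearBl/=; lra.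
lra.
Qed.

End proximity_operator.

(** * Propagation of differences through a chain of firmly nonexpansive layers *)

Section firmly_nonexpansive_chain.
Context {R : realType} {V : lmodType R}.
Variables (N : V -> R) (L : nat -> V -> V).
Hypothesis N_triangle : forall x y, N (x + y) <= N x + N y.
Hypothesis N_scale : forall (c : R) x, N (c *: x) = `|c| * N x.
Hypothesis L_linear : forall n, linear (L n).

(** The product L_n ... L_(j+1), empty when n <= j. The index [j] counts the layers already applied,
    so it corresponds to i = j + 1 in the coefficients. *)
Fixpoint layer_comp (j n : nat) (z : V) : V :=
  if n is n'.+1 then
    if (j <= n')%N then L n (layer_comp j n' z) else z
  else z.

Lemma layer_compS (j n : nat) (z : V) : (j <= n)%N ->
  layer_comp j n.+1 z = L n.+1 (layer_comp j n z).
Proof. by move=> /= ->. Qed.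

Lemma layer_comp_id (n : nat) (z : V) : layer_comp n n z = z.
Proof. by case: n => //= n; rewrite ltnn. Qed.

Lemma layer0 (n : nat) : L n 0 = 0.
Proof. by have := L_linear n (-1) 0 0; rewrite scaler0 addr0 scaleN1r addNr. Qed.

Lemma layerZ (n : nat) (c : R) (z : V) : L n (c *: z) = c *: L n z.
Proof. by have := L_linear n c z 0; rewrite layer0 !addr0. Qed.

Lemma layer_sum (n k : nat) (F : nat -> V) :
  L n (\sum_(j < k) F j) = \sum_(j < k) L n (F j).
Proof.
apply: (big_morph (L n)) => [x y|]; last exact: layer0.
by have := L_linear n 1 x y; rewrite !scale1r.
Qed.

Lemma N_sum_le (k : nat) (F : nat -> V) (G : nat -> R) :
  (forall j, (j < k)%N -> N (F j) <= G j) ->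
  N (\sum_(j < k) F j) <= \sum_(j < k) G j.
Proof.
elim: k => [|k IH] FG.
  by rewrite !big_ord0 -(scale0r (0 : V)) N_scale normr0 mul0r.
rewrite !big_ord_recr/= (le_trans (N_triangle _ _))// lerD// ?FG//.
by apply: IH => j jk; apply: FG; exact: ltnW.
Qed.

Variables (m : nat) (delta : nat -> V) (K : nat -> nat -> R) (theta : nat -> R).
Hypothesis delta_firm : forall n, (n < m)%N ->
  N (2 *: delta n.+1 - L n.+1 (delta n)) <= N (L n.+1 (delta n)).
Hypothesis K_ge0 : forall j n, 0 <= K j n.
Hypothesis K_bound : forall j n z, (j < n <= m)%N ->
  N (layer_comp j n z) <= K j n * N z.
Hypothesis theta0 : theta 0%N = 1.
Hypothesis thetaS : forall n, (0 < n < m)%N ->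
  theta n = \sum_(j < n) theta j * K j n.

Let r (j : nat) : V :=
  if j is j'.+1 then 2 ^+ j' *: (2 *: delta j - L j (delta j')) else delta 0%N.

(** The powers of 2 in [r] are chosen so that 2^(n+1) delta_(n+1) = L_(n+1) (2^n delta_n) + r_(n+1);
    iterating this recurrence gives the sum. *)
Lemma chain_expansion (n : nat) :
  2 ^+ n *: delta n = \sum_(j < n.+1) layer_comp j n (r j).
Proof.
elim: n => [|n IH]; first by rewrite big_ord1 expr0 scale1r.
rewrite big_ord_recr layer_comp_id.
rewrite (eq_bigr (fun j : 'I_n.+1 => L n.+1 (layer_comp j n (r j)))); last first.
  by move=> j _; apply: layer_compS; exact: (ltn_ord j).
by rewrite -(layer_sum _ _ (fun j => layer_comp j n (r j))) -IH layerZ/=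
  scalerBr addrC subrK exprSr scalerA.
Qed.

(** By firmness the residual is at most |L_(n+1) (2^n delta_n)|, which expands over earlier
    residuals. The bound is kept as a sum because at n + 1 = m it becomes the quantity thetabar,
    outside the range of the recurrence [thetaS]. *)
Lemma chain_residual_le (n : nat) : (n < m)%N ->
  (forall j, (j <= n)%N -> N (r j) <= theta j * N (delta 0%N)) ->
  N (r n.+1) <= (\sum_(j < n.+1) theta j * K j n.+1) * N (delta 0%N).
Proof.
move=> nm rn; rewrite /r N_scale.
apply: (le_trans (ler_wpM2l (normr_ge0 _) (delta_firm nm))).
rewrite -N_scale -layerZ chain_expansion.
rewrite (layer_sum _ _ (fun j => layer_comp j n (r j))).
rewrite (eq_bigr (fun j : 'I_n.+1 => layer_comp j n.+1 (r j))); last first.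
  by move=> j _; rewrite layer_compS//; exact: (ltn_ord j).
rewrite mulr_suml; apply: (@N_sum_le n.+1 (fun j => layer_comp j n.+1 (r j))
  (fun j => theta j * K j n.+1 * N (delta 0%N))) => j jn.
rewrite (le_trans (K_bound _ _)) ?jn// mulrAC [leRHS]mulrC.
by rewrite ler_wpM2l// rn.
Qed.

Lemma chain_residual_theta (n : nat) : (n < m)%N ->
  N (r n) <= theta n * N (delta 0%N).
Proof.
elim/ltn_ind: n => -[|n] IH nm; first by rewrite theta0 mul1r.
rewrite thetaS//; apply: (chain_residual_le (ltnW nm)).
move=> j jn; apply: IH; first by rewrite ltnS.
exact: leq_ltn_trans (ltnW nm).
Qed.

(* [2 ^+ m *: delta m] is the linear part [layer_comp 0 m (delta 0)] plus terms
   produced by the reflected activations, controlled by [theta]. *)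
Lemma chain_averaged (c B : R) (S := \sum_(j < m) theta j * K j m) :
  (0 < m)%N ->
  (forall z, N (layer_comp 0 m z - c *: z) <= B * N z) ->
  N (2 ^+ m *: delta m - c *: delta 0%N) <=
    (B + (S - K 0%N m) + S) * N (delta 0%N).
Proof.
rewrite {}/S => m0 Bz.
have [m' mE] : exists m', m = m'.+1 by exists m.-1; rewrite prednK.
have rm : N (r m) <= (\sum_(j < m) theta j * K j m) * N (delta 0%N).
  have := @chain_residual_le m'; rewrite -mE; apply=> // j jm'.
  by apply: chain_residual_theta; rewrite mE ltnS.
have sumV (F : nat -> V) :
    \sum_(j < m.+1) F j = F 0%N + \sum_(j < m') F j.+1 + F m.
  by rewrite mE big_ord_recr big_ord_recl.
have sumR (F : nat -> R) : \sum_(j < m) F j = F 0%N + \sum_(j < m') F j.+1.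
  by rewrite mE big_ord_recl.
(* Three pieces: the term j = 0 shifted by [c] costs [B], the middle terms cost S - K 0 m because
   theta_0 = 1, and the last residual r_m costs S. *)
rewrite chain_expansion (sumV (fun j => layer_comp j m (r j))) layer_comp_id.
rewrite addrAC mulrDl (le_trans (N_triangle _ _))// lerD//.
rewrite (sumR (fun j => theta j * K j m)) theta0 mul1r.
rewrite addrAC (addrC (K _ _)) addrK mulrDl.
rewrite (le_trans (N_triangle _ _))// lerD// mulr_suml.
apply: (@N_sum_le m' (fun j => layer_comp j.+1 m (r j.+1))
  (fun j => theta j.+1 * K j.+1 m * N (delta 0%N))) => j jm'.
have jm : (j.+1 < m)%N by rewrite mE ltnS.
rewrite (le_trans (K_bound _ _)) ?jm ?leqnn// mulrAC [leRHS]mulrC.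
by rewrite ler_wpM2l// chain_residual_theta.
Qed.

End firmly_nonexpansive_chain.

(** * Norms of triangular 2x2 matrices and finiteness of their suprema *)

Section quadratic_forms.
Context {R : realType}.
Implicit Types (b t e x y : R).

(* The factor [l] is the largest eigenvalue of the Gram matrix of
   [[b, t], [0, e]], i.e. the largest root of [l^2 - s l + b^2 e^2]. *)
Lemma triangular_form_le b t e x y (s := b ^+ 2 + t ^+ 2 + e ^+ 2)
    (l := 2^-1 * (s + Num.sqrt (s ^+ 2 - 4 * b ^+ 2 * e ^+ 2))) :
  (b * x + t * y) ^+ 2 + (e * y) ^+ 2 <= l * (x ^+ 2 + y ^+ 2).
Proof.
have disc : 0 <= s ^+ 2 - 4 * b ^+ 2 * e ^+ 2.
  rewrite [X in 0 <= X](_ : _ = (b ^+ 2 - e ^+ 2) ^+ 2 +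
    t ^+ 2 * (t ^+ 2 + 2 * b ^+ 2 + 2 * e ^+ 2)); last by rewrite /s; ring.
  apply: addr_ge0; [exact: sqr_ge0|apply: mulr_ge0; first exact: sqr_ge0].
  by have := sqr_ge0 b; have := sqr_ge0 t; have := sqr_ge0 e; lra.
have sq := sqr_sqrtr disc; have sq0 := sqrtr_ge0 (s ^+ 2 - 4 * b ^+ 2 * e ^+ 2).
(* The matrix l Id minus the Gram matrix has zero determinant and, as shown next, nonnegative trace;
   hence it is positive semidefinite. The end of the proof checks this by completing the square. *)
have l_root : (l - b ^+ 2) * (l - t ^+ 2 - e ^+ 2) = (b * t) ^+ 2.
  move: sq; rewrite /l; set w := Num.sqrt _; rewrite /s => sq.
  apply/eqP; rewrite -subr_eq0; apply/eqP.
  rewrite [LHS](_ : _ = 4^-1 * (w ^+ 2 -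
    ((b ^+ 2 + t ^+ 2 + e ^+ 2) ^+ 2 - 4 * b ^+ 2 * e ^+ 2))); last by field.
  by rewrite sq subrr mulr0.
have sum_ge0 : 0 <= (l - b ^+ 2) + (l - t ^+ 2 - e ^+ 2).
  by rewrite /l; move: sq0; set w := Num.sqrt _; rewrite /s; lra.
have prod_ge0 : 0 <= (l - b ^+ 2) * (l - t ^+ 2 - e ^+ 2).
  by rewrite l_root sqr_ge0.
rewrite -subr_ge0 [X in 0 <= X](_ : _ = (l - b ^+ 2) * x ^+ 2
  - 2 * (b * t) * (x * y) + (l - t ^+ 2 - e ^+ 2) * y ^+ 2); last by ring.
move: (l - b ^+ 2) (l - t ^+ 2 - e ^+ 2) (b * t) l_root sum_ge0 prod_ge0.
move=> A C D AC sum_ge0 prod_ge0.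
have A0 : 0 <= A by nra.
have C0 : 0 <= C by nra.
have [A_0|A_neq0] := eqVneq A 0.
  have D0 : D = 0 by apply/eqP; rewrite -sqrf_eq0 -AC A_0 mul0r.
  by rewrite A_0 D0; have := mulr_ge0 C0 (sqr_ge0 y); lra.
have A_gt0 : 0 < A by rewrite lt_neqAle eq_sym A_neq0.
rewrite -(pmulr_rge0 _ A_gt0).
rewrite [X in 0 <= X](_ : _ = (A * x - D * y) ^+ 2 + (A * C - D ^+ 2) * y ^+ 2);
  last by ring.
by rewrite AC subrr mul0r addr0 sqr_ge0.
Qed.

Lemma bounded_seq_cst (c : R) : bounded_seq (fun=> c).
Proof. by exists `|c|. Qed.

Lemma bounded_seq_add (f g : nat -> R) :
  bounded_seq f -> bounded_seq g -> bounded_seq (fun p => f p + g p).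
Proof.
move=> [M fM] [M' gM']; exists (M + M') => p.
by rewrite (le_trans (ler_normD _ _))// lerD.
Qed.

Lemma bounded_seq_opp (f : nat -> R) :
  bounded_seq f -> bounded_seq (fun p => - f p).
Proof. by move=> [M fM]; exists M => p; rewrite normrN. Qed.

Lemma bounded_seq_mul (f g : nat -> R) :
  bounded_seq f -> bounded_seq g -> bounded_seq (fun p => f p * g p).
Proof.
move=> [M fM] [M' gM']; exists (M * M') => p.
by rewrite normrM ler_pM.
Qed.

Lemma bounded_seq_sum (r : seq nat) (F : nat -> nat -> R) :
  (forall i, bounded_seq (F i)) -> bounded_seq (fun p => \sum_(i <- r) F i p).
Proof.
move=> bF; elim: r => [|i r IH].
  by under eq_fun do rewrite big_nil; exact: bounded_seq_cst.
by under eq_fun do rewrite big_cons; exact: bounded_seq_add.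
Qed.

Lemma bounded_seq_prod (r : seq nat) (F : nat -> nat -> R) :
  (forall i, bounded_seq (F i)) -> bounded_seq (fun p => \prod_(i <- r) F i p).
Proof.
move=> bF; elim: r => [|i r IH].
  by under eq_fun do rewrite big_nil; exact: bounded_seq_cst.
by under eq_fun do rewrite big_cons; exact: bounded_seq_mul.
Qed.

Lemma bounded_seq_sqr (f : nat -> R) :
  bounded_seq f -> bounded_seq (fun p => f p ^+ 2).
Proof. by move=> bf; exact: bounded_seq_mul. Qed.

(** The real-valued [sup] is meaningful only on bounded sets, hence the boundedness lemmas above. *)
Lemma le_sup_seq (f : nat -> R) (p : nat) :
  bounded_seq f -> f p <= sup (range f).
Proof.
move=> [M fM]; apply: ub_le_sup; last by exists p.
by exists M => _ [q _ <-]; exact: le_trans (ler_norm _) (fM q).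
Qed.

Lemma triangular_form_le_sup (b t : nat -> R) (e x y : R) (p : nat) :
  bounded_seq b -> bounded_seq t ->
  (b p * x + t p * y) ^+ 2 + (e * y) ^+ 2 <=
  2^-1 * sup (range (fun p => let s := b p ^+ 2 + t p ^+ 2 + e ^+ 2 in
    s + Num.sqrt (s ^+ 2 - 4 * b p ^+ 2 * e ^+ 2))) * (x ^+ 2 + y ^+ 2).
Proof.
move=> bb bt; apply: (le_trans (triangular_form_le _ _ _ _ _)).
rewrite ler_wpM2r ?addr_ge0 ?sqr_ge0// ler_wpM2l//.
set f := fun p => _.
apply: (@le_sup_seq f p).
have bs : bounded_seq (fun p => b p ^+ 2 + t p ^+ 2 + e ^+ 2).
  apply: bounded_seq_add (bounded_seq_cst _).
  by apply: bounded_seq_add; exact: bounded_seq_sqr.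
(* A nonnegative quantity is subtracted from s^2, so the square root is at most |s| and the bound
   [M] for [s] serves again. *)
apply: (bounded_seq_add bs); have [M sM] := bs; exists M => q.
rewrite ger0_norm ?sqrtr_ge0// (le_trans _ (sM q))// -sqrtr_sqr ler_wsqrtr//.
rewrite lerBlDr lerDl.
by apply: mulr_ge0; [apply: mulr_ge0|]; rewrite ?sqr_ge0.
Qed.

(** Cauchy-Schwarz in the plane for the row (b, t), the case where the second row of the matrix
    vanishes. *)
Lemma row_form_le_sup (b t : nat -> R) (x y : R) (p : nat) :
  bounded_seq b -> bounded_seq t ->
  (b p * x + t p * y) ^+ 2 <=
  sup (range (fun p => b p ^+ 2 + t p ^+ 2)) * (x ^+ 2 + y ^+ 2).
Proof.
move=> bb bt.
apply: (@le_trans _ _ ((b p ^+ 2 + t p ^+ 2) * (x ^+ 2 + y ^+ 2))).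
  by have := sqr_ge0 (b p * y - t p * x); nra.
rewrite ler_wpM2r ?addr_ge0 ?sqr_ge0//.
apply: (@le_sup_seq (fun p => b p ^+ 2 + t p ^+ 2)).
by apply: bounded_seq_add; exact: bounded_seq_sqr.
Qed.

End quadratic_forms.

(** * The Euclidean norm on the product space *)

Section product_norm.
Context {R : realType} {X : completeNormedModType R}.
Implicit Types (u w : X * X).

Lemma prod_norm_sqr u : prod_norm u ^+ 2 = `|u.1| ^+ 2 + `|u.2| ^+ 2.
Proof. by rewrite sqr_sqrtr// addr_ge0 ?sqr_ge0. Qed.

Lemma prod_norm_ge0 u : 0 <= prod_norm u.
Proof. exact: sqrtr_ge0. Qed.

Lemma prod_normD u w : prod_norm (u + w) <= prod_norm u + prod_norm w.
Proof.
rewrite -(@ler_pXn2r _ 2)// ?nnegrE ?addr_ge0 ?prod_norm_ge0//.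
rewrite prod_norm_sqr sqrrD !prod_norm_sqr.
have cs : `|u.1| * `|w.1| + `|u.2| * `|w.2| <= prod_norm u * prod_norm w.
  rewrite -(@ler_pXn2r _ 2)// ?nnegrE ?addr_ge0 ?mulr_ge0 ?prod_norm_ge0//.
  rewrite exprMn !prod_norm_sqr.
  by have := sqr_ge0 (`|u.1| * `|w.2| - `|u.2| * `|w.1|); lra.
have h (x y : X) : `|x + y| ^+ 2 <= `|x| ^+ 2 + 2 * (`|x| * `|y|) + `|y| ^+ 2.
  rewrite [leRHS](_ : _ = (`|x| + `|y|) ^+ 2); last by ring.
  by rewrite ler_pXn2r ?nnegrE ?addr_ge0// ler_normD.
have := h u.1 w.1; have := h u.2 w.2; rewrite mulr2n; lra.
Qed.

Lemma prod_normZ (c : R) u : prod_norm (c *: u) = `|c| * prod_norm u.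
Proof.
rewrite /prod_norm/= !normrZ !exprMn -mulrDr sqrtrM ?sqr_ge0//.
by rewrite sqrtr_sqr normr_id.
Qed.

Lemma prod_norm_le (c : R) u w :
  `|u.1| ^+ 2 + `|u.2| ^+ 2 <= c * (`|w.1| ^+ 2 + `|w.2| ^+ 2) ->
  prod_norm u <= Num.sqrt c * prod_norm w.
Proof.
move=> le; rewrite mulrC -sqrtrM ?addr_ge0 ?sqr_ge0//.
by rewrite ler_wsqrtr// mulrC.
Qed.

(** Summing the coordinatewise bounds and passing to the limit with Parseval reduces operator norms
    to 2x2 matrices with a common constant. *)
Lemma prod_norm_le_coord (d : {dot X for idfun}) (v : nat -> X) (c : R) u w :
  hilbert_dot d -> orthonormal_basis d v ->
  (forall p, d u.1 (v p) ^+ 2 + d u.2 (v p) ^+ 2 <=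
             c * (d w.1 (v p) ^+ 2 + d w.2 (v p) ^+ 2)) ->
  prod_norm u <= Num.sqrt c * prod_norm w.
Proof.
move=> hd vb le; apply: prod_norm_le.
have pars z : (\sum_(p < n) d z (v p) ^+ 2) @[n --> \oo] --> `|z| ^+ 2.
  exact: parseval.
have pars2 (z : X * X) :
    (\sum_(p < n) d z.1 (v p) ^+ 2 + \sum_(p < n) d z.2 (v p) ^+ 2)
      @[n --> \oo] --> `|z.1| ^+ 2 + `|z.2| ^+ 2.
  exact: cvgD (pars _) (pars _).
have pars2c :
    (c * (\sum_(p < n) d w.1 (v p) ^+ 2 + \sum_(p < n) d w.2 (v p) ^+ 2))
      @[n --> \oo] --> c * (`|w.1| ^+ 2 + `|w.2| ^+ 2).
  by apply: cvgM (pars2 w); exact: cvg_cst.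
apply: ler_cvg_to (pars2 u) pars2c _; apply: nearW => n.
rewrite -!big_split/= mulr_sumr; apply: ler_sum => p _; exact: le.
Qed.

End product_norm.

(** * Recurrences and boundedness of the coefficients *)

Section coefficient_recurrences.
Context {R : realType}.
Variables (betaT betaD lam tau eta : nat -> R).
Hypothesis eta1 : forall n, eta n = 1.

Lemma eta_prod1 (i j : nat) : eta_prod eta i j = 1.
Proof. by rewrite /eta_prod big1. Qed.

Lemma beta_prodS (j n p : nat) : (j <= n)%N ->
  beta_prod betaT betaD lam tau j.+1 n.+1 p =
  beta_layer betaT betaD lam tau n.+1 p * beta_prod betaT betaD lam tau j.+1 n p.
Proof. by move=> jn; rewrite /beta_prod big_nat_recr//= mulrC. Qed.

(** A new layer multiplies all earlier input contributions by its eigenvalue and adds its own. The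
    isolated term lam_n becomes the last summand of the longer sum. *)
Lemma tbetaS (j n p : nat) : (j < n)%N ->
  tbeta betaT betaD lam tau eta j.+1 n.+1 p =
  beta_layer betaT betaD lam tau n.+1 p * tbeta betaT betaD lam tau eta j.+1 n p
    + lam n.+1.
Proof.
move=> jn; rewrite /tbeta eta_prod1 mulr1; congr (_ + _).
rewrite big_nat_recr//= big_nat1 eta_prod1 !mulr1 mulrDr.
congr (_ + _); rewrite mulr_sumr; apply: eq_big_nat => i /andP[_ i_n].
by rewrite eta_prod1 !mulr1 (big_nat_recr n.+1) ?ltnS 1?ltnW//= mulrAC [LHS]mulrC.
Qed.

Lemma tbeta_id (j p : nat) : tbeta betaT betaD lam tau eta j j p = lam j.
Proof. by rewrite /tbeta big_geq// add0r eta_prod1 mulr1. Qed.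

Lemma beta_prod_id (j p : nat) :
  beta_prod betaT betaD lam tau j j p = beta_layer betaT betaD lam tau j p.
Proof. by rewrite /beta_prod big_nat1. Qed.

Hypotheses (bT : bounded_seq betaT) (bD : bounded_seq betaD).

Lemma beta_layer_bounded (n : nat) :
  bounded_seq (beta_layer betaT betaD lam tau n).
Proof.
rewrite /beta_layer; apply: bounded_seq_add; first exact: bounded_seq_cst.
apply: bounded_seq_opp; apply: bounded_seq_mul; first exact: bounded_seq_cst.
by apply: bounded_seq_add => //; apply: bounded_seq_mul => //; exact: bounded_seq_cst.
Qed.

Lemma beta_prod_bounded (i n : nat) :
  bounded_seq (beta_prod betaT betaD lam tau i n).
Proof. exact: bounded_seq_prod beta_layer_bounded. Qed.

Lemma tbeta_bounded (i n : nat) :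
  bounded_seq (tbeta betaT betaD lam tau eta i n).
Proof.
rewrite /tbeta; apply: bounded_seq_add; last exact: bounded_seq_cst.
apply: bounded_seq_sum => j; apply: bounded_seq_mul; last exact: bounded_seq_cst.
apply: bounded_seq_mul; last exact: bounded_seq_cst.
exact: bounded_seq_prod beta_layer_bounded.
Qed.

End coefficient_recurrences.

(** * Products of the linear layers in the eigenbasis *)

Section affine_layers.
Context {R : realType} {X Y Z : completeNormedModType R}.
Variables (dotX : {dot X for idfun}) (dotY : {dot Y for idfun})
  (dotZ : {dot Z for idfun}).
Hypothesis hilbX : hilbert_dot dotX.
Variables (T : {linear X -> Y}) (Tstar : Y -> X)
  (D : {linear X -> Z}) (Dstar : Z -> X).
Hypotheses (Tadj : is_adjoint dotX dotY T Tstar)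
  (Dadj : is_adjoint dotX dotZ D Dstar).
Variables (v : nat -> X) (betaT betaD lam tau eta : nat -> R).
Hypotheses (eigT : forall p, Tstar (T (v p)) = betaT p *: v p)
  (eigD : forall p, Dstar (D (v p)) = betaD p *: v p)
  (eta1 : forall n, eta n = 1).

(* The linear part of layer [n] acting on state-input pairs; the factor [e n]
   propagates ([e n = 1]) or discards ([e n = 0]) the input. *)
Definition pair_layer (e : nat -> R) (n : nat) (u : X * X) : X * X :=
  (Wlayer T Tstar D Dstar lam tau n u.1 + Vlayer lam n u.2, e n *: u.2).

Lemma Wlayer_linear (n : nat) : linear (Wlayer T Tstar D Dstar lam tau n).
Proof.
move=> c x y; rewrite /Wlayer !linearP.
rewrite (adjoint_is_linear hilbX Tadj) (adjoint_is_linear hilbX Dadj).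
rewrite !scalerDr !scalerN !scalerA (mulrC c (lam n)) (mulrC c (lam n * _)).
by rewrite !opprD (addrACA (c *: x)) (addrACA (c *: x - _)).
Qed.

Lemma pair_layer_linear (e : nat -> R) (n : nat) : linear (pair_layer e n).
Proof.
move=> c u w; rewrite /pair_layer/= Wlayer_linear /Vlayer.
congr pair => /=; last by rewrite scalerDr !scalerA mulrC.
by rewrite !scalerDr !scalerA (mulrC c) addrACA.
Qed.

Lemma Wlayer_coord (n p : nat) (x : X) :
  dotX (Wlayer T Tstar D Dstar lam tau n x) (v p) =
  beta_layer betaT betaD lam tau n p * dotX x (v p).
Proof.
rewrite /Wlayer !linearBl/= !dotZl.
rewrite (adjoint_eigen Tadj _ (eigT p)) (adjoint_eigen Dadj _ (eigD p)).
by rewrite /beta_layer; ring.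
Qed.

(** Only the factors strictly before [n] are required to be 1, so that both a final layer keeping
    the input and one discarding it are covered. *)
Lemma layer_comp_snd (e : nat -> R) (j n : nat) (u : X * X) : (j < n)%N ->
  (forall k, (j < k < n)%N -> e k = 1) ->
  (layer_comp (pair_layer e) j n u).2 = e n *: u.2.
Proof.
elim: n => // n IH; rewrite ltnS => jn e1; rewrite layer_compS//=.
congr (_ *: _); move: jn; rewrite leq_eqVlt => /predU1P[<-|jn].
  by rewrite layer_comp_id.
rewrite IH// => [|k /andP[jk kn]]; last by rewrite e1// jk ltnW.
by rewrite e1 ?jn ?ltnSn// scale1r.
Qed.

(** First row of the product of the matrices [[beta_k, lam_k], [0, e_k]] for k from j + 1 to n; the
    recurrences of the coefficients match left multiplication by one more factor. *)
Lemma layer_comp_coord (e : nat -> R) (j n p : nat) (u : X * X) : (j < n)%N ->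
  (forall k, (j < k < n)%N -> e k = 1) ->
  dotX (layer_comp (pair_layer e) j n u).1 (v p) =
  beta_prod betaT betaD lam tau j.+1 n p * dotX u.1 (v p) +
  tbeta betaT betaD lam tau eta j.+1 n p * dotX u.2 (v p).
Proof.
elim: n => // n IH; rewrite ltnS => jn e1; rewrite layer_compS//=.
rewrite linearDl/= Wlayer_coord /Vlayer dotZl.
move: jn; rewrite leq_eqVlt => /predU1P[<-|jn].
  by rewrite layer_comp_id beta_prod_id tbeta_id.
have e1' k : (j < k < n)%N -> e k = 1.
  by move=> /andP[jk kn]; rewrite e1// jk ltnW.
rewrite IH// layer_comp_snd// e1 ?jn ?ltnSn// scale1r.
rewrite (beta_prodS _ _ _ _ _ (ltnW jn)) (tbetaS _ _ _ _ eta1 _ jn).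
move: (beta_layer _ _ _ _ _ _) (beta_prod _ _ _ _ _ _ _).
by move: (tbeta _ _ _ _ _ _ _ _) => t b b1; ring.
Qed.

Hypotheses (vbasis : orthonormal_basis dotX v)
  (bT : bounded_seq betaT) (bD : bounded_seq betaD).

Lemma layer_comp_le_a (e : nat -> R) (j n : nat) (u : X * X) : (j < n)%N ->
  (forall k, (j < k <= n)%N -> e k = 1) ->
  prod_norm (layer_comp (pair_layer e) j n u) <=
  Num.sqrt (a_coef betaT betaD lam tau eta j.+1 n) * prod_norm u.
Proof.
move=> jn e1; apply: (prod_norm_le_coord hilbX vbasis) => p.
have e1' k : (j < k < n)%N -> e k = 1.
  by move=> /andP[jk kn]; rewrite e1// jk ltnW.
rewrite layer_comp_coord// layer_comp_snd// dotZl e1 ?jn ?leqnn//.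
rewrite /a_coef eta_prod1//.
apply: (@triangular_form_le_sup R (beta_prod betaT betaD lam tau j.+1 n)
  (tbeta betaT betaD lam tau eta j.+1 n) 1).
- exact: beta_prod_bounded.
- exact: tbeta_bounded.
Qed.

Lemma layer_comp_le_abar (e : nat -> R) (j n : nat) (u : X * X) : (j < n)%N ->
  (forall k, (j < k < n)%N -> e k = 1) -> e n = 0 ->
  prod_norm (layer_comp (pair_layer e) j n u) <=
  Num.sqrt (abar_coef betaT betaD lam tau eta j.+1 n) * prod_norm u.
Proof.
move=> jn e1 en; apply: (prod_norm_le_coord hilbX vbasis) => p.
rewrite layer_comp_coord// layer_comp_snd// dotZl en mul0r expr0n addr0.
apply: row_form_le_sup.
- exact: beta_prod_bounded.
- exact: tbeta_bounded.
Qed.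

(** With c = gamma, subtracting c Id from a product that discards the input gives the matrix
    [[beta - c, tbeta], [0, -c]]; the sign of the last entry disappears on squaring. *)
Lemma layer_comp_le_bbar (e : nat -> R) (n : nat) (alpha : R) (u : X * X) :
  (0 < n)%N -> (forall k, (0 < k < n)%N -> e k = 1) -> e n = 0 ->
  prod_norm (layer_comp (pair_layer e) 0 n u - gamma_coef n alpha *: u) <=
  Num.sqrt (bbar_coef betaT betaD lam tau eta n alpha) * prod_norm u.
Proof.
move=> n0 e1 en; apply: (prod_norm_le_coord hilbX vbasis) => p /=.
rewrite !linearBl/= layer_comp_coord// layer_comp_snd// !dotZl en mul0r sub0r.
rewrite /bbar_coef; set c := gamma_coef n alpha.
rewrite [X in X ^+ 2 + _](_ : _ =
  (beta_prod betaT betaD lam tau 1 n p - c) * dotX u.1 (v p)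
  + tbeta betaT betaD lam tau eta 1 n p * dotX u.2 (v p)); last by ring.
rewrite sqrrN.
apply: (@triangular_form_le_sup R
  (fun p => beta_prod betaT betaD lam tau 1 n p - c)
  (tbeta betaT betaD lam tau eta 1 n)).
- exact: bounded_seq_add (beta_prod_bounded _ _ _ _ _ _) (bounded_seq_cst _).
- exact: tbeta_bounded.
Qed.

End affine_layers.

(** * Averagedness of the network *)

Theorem proposition3p10 (R : realType)
    (X Y Z : completeNormedModType R)
    (dotX : {dot X for idfun}) (dotY : {dot Y for idfun})
    (dotZ : {dot Z for idfun})
    (hilbX : hilbert_dot dotX) (hilbY : hilbert_dot dotY)
    (hilbZ : hilbert_dot dotZ)
    (evX : X -> R -> R) (evY : Y -> R -> R)
    (fspX : function_space evX) (fspY : function_space evY)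
    (k : R * R -> R) (kL2 : L2_kernel k)
    (T : {linear X -> Y}) (Tstar : Y -> X)
    (Tint : integral_operator evX evY k T) (Tcpt : compact_operator T)
    (Tadj : is_adjoint dotX dotY T Tstar)
    (D : {linear X -> Z}) (Dstar : Z -> X)
    (Dadj : is_adjoint dotX dotZ D Dstar)
    (TDcomm : forall x : X,
       Tstar (T (Dstar (D x))) = Dstar (D (Tstar (T x))))
    (v : nat -> X) (vbasis : orthonormal_basis dotX v)
    (betaT betaD : nat -> R)
    (eigT : forall p : nat, Tstar (T (v p)) = betaT p *: v p)
    (eigD : forall p : nat, Dstar (D (v p)) = betaD p *: v p)
    (g : X -> \bar R) (gproper : proper_fun g)
    (glsc : lower_semicontinuous g) (gconvex : convex_efun g)
    (m : nat) (m_gt1 : (1 < m)%N)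
    (lam mu tau eta : nat -> R)
    (lam_gt0 : forall n : nat, (1 <= n <= m)%N -> 0 < lam n)
    (mu_gt0 : forall n : nat, (1 <= n <= m)%N -> 0 < mu n)
    (tau_gt0 : forall n : nat, (1 <= n <= m)%N -> 0 < tau n)
    (eta1 : forall n : nat, eta n = 1)
    (a abar : nat -> nat -> R)
    (aE : forall n i : nat, (1 <= n <= m.-1)%N -> (1 <= i <= n)%N ->
       a i n = a_coef betaT betaD lam tau eta i n)
    (abarE : forall i : nat, (1 <= i <= m)%N ->
       abar i m = abar_coef betaT betaD lam tau eta i m)
    (theta : nat -> R) (theta0 : theta 0%N = 1)
    (thetaE : forall n : nat, (1 <= n <= m.-1)%N ->
       theta n = \sum_(1 <= i < n.+1) theta i.-1 * Num.sqrt (a i n))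
    (thetabar : R)
    (thetabarE :
       thetabar = \sum_(1 <= i < m.+1) theta i.-1 * Num.sqrt (abar i m))
    (alpha : R) (alpha_bnd : 2^-1 <= alpha <= 1)
    (Hmain :
       Num.sqrt (bbar_coef betaT betaD lam tau eta m alpha)
         - Num.sqrt (abar 1%N m) <= 2 ^+ m * alpha - 2 * thetabar) :
  averaged (@prod_norm R X) alpha
    (network T Tstar D Dstar g lam mu tau m).
Proof.
have bT := adjoint_eigen_bounded hilbX hilbY Tadj vbasis.1 eigT.
have bD := adjoint_eigen_bounded hilbX hilbZ Dadj vbasis.1 eigD.
have m0 : (0 < m)%N by exact: ltnW.
have /andP[alpha_ge alpha_le] := alpha_bnd.
have alpha0 : 0 < alpha by apply: lt_le_trans alpha_ge; rewrite invr_gt0.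
(* Every layer but the last carries the input along; the last one discards it, which produces the
   output (x_m, 0). *)
pose e (n : nat) : R := (n < m)%:R.
have em : e m = 0 by rewrite /e ltnn.
have e1 n : (n < m)%N -> e n = 1 by rewrite /e => ->.
pose L := pair_layer T Tstar D Dstar lam tau e.
have L_linear n : linear (L n) by exact: (pair_layer_linear hilbX Tadj Dadj).
pose net := network T Tstar D Dstar g lam mu tau m.
have net_contract (u w : X * X) :
    prod_norm (net u - net w - (1 - alpha) *: (u - w)) <=
    alpha * prod_norm (u - w).
  pose Zst n (z : X * X) : X * X :=
    (net_state T Tstar D Dstar g lam mu tau n z.1 z.2, e n *: z.2).
  pose delta n := Zst n u - Zst n w.
  have delta0 : delta 0%N = u - w.
    by rewrite /delta /Zst/= e1// !scale1r -!surjective_pairing.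
  have deltam : delta m = net u - net w.
    by rewrite /delta /Zst em !scale0r.
  (* Products that end at the last layer have zero second row, whence [abar] in place of [a]. *)
  pose K j n := Num.sqrt (if n == m then abar j.+1 m else a j.+1 n).
  have Kb j n z : (j < n <= m)%N ->
      prod_norm (layer_comp L j n z) <= K j n * prod_norm z.
    move=> /andP[jn nm]; rewrite /K; have [->|n_neq] := eqVneq n m.
      rewrite abarE ?(leq_trans jn)//.
      apply: (layer_comp_le_abar hilbX Tadj Dadj _ _ eigT eigD) => //.
        exact: leq_trans nm.
      by move=> k' /andP[_ /e1].
    have n_lt : (n < m)%N by rewrite ltn_neqAle n_neq.
    rewrite aE//; last by rewrite (leq_ltn_trans _ jn)//= -ltnS prednK.
    apply: (layer_comp_le_a hilbX Tadj Dadj _ _ eigT eigD) => // k' /andP[_ k'n].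
    by apply: e1; exact: leq_ltn_trans n_lt.
  have thK n : (0 < n < m)%N -> theta n = \sum_(j < n) theta j * K j n.
    move=> /andP[n0 nm]; rewrite thetaE; last by rewrite n0 -ltnS prednK.
    by rewrite big_add1 big_mkord; apply: eq_bigr => j _; rewrite /K ltn_eqF.
  have thbarK : thetabar = \sum_(j < m) theta j * K j m.
    rewrite thetabarE big_add1 big_mkord.
    by apply: eq_bigr => j _; rewrite /K eqxx.
  have firm n : (n < m)%N ->
      prod_norm (2 *: delta n.+1 - L n.+1 (delta n)) <=
      prod_norm (L n.+1 (delta n)).
    move=> nm.
    have LE : L n.+1 (delta n) = L n.+1 (Zst n u) - L n.+1 (Zst n w).
      have -> : delta n = (-1) *: Zst n w + Zst n u by rewrite scaleN1r addrC.
      by rewrite L_linear scaleN1r addrC.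
    rewrite LE /prod_norm ler_wsqrtr//; apply: lerD.
      rewrite lerXn2r ?nnegrE//.
      have step z : (Zst n.+1 z).1 = Rlayer g lam mu n.+1 (L n.+1 (Zst n z)).1.
        by rewrite /Zst /L /pair_layer/= (e1 n)// scale1r.
      have -> : (2 *: delta n.+1 - (L n.+1 (Zst n u) - L n.+1 (Zst n w))).1 =
          2 *: ((Zst n.+1 u).1 - (Zst n.+1 w).1) -
          ((L n.+1 (Zst n u)).1 - (L n.+1 (Zst n w)).1) by [].
      rewrite !step; apply: (reflected_prox_nonexpansive hilbX) => //.
      by rewrite mulr_gt0// ?lam_gt0// mu_gt0.
    rewrite lerXn2r ?nnegrE//= (e1 n)// !scale1r.
    (* On the input component the activation is the identity, whose reflection is again the
       identity. *)
    set b := (X in 2 *: X); have -> : 2 *: b - b = b; last by [].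
    by rewrite scaler_nat mulr2n addrK.
  have := chain_averaged prod_normD (@prod_normZ R X) L_linear firm
    (fun j n => sqrtr_ge0 _) Kb theta0 thK m0.
  move=> /(_ (gamma_coef m alpha)
    (Num.sqrt (bbar_coef betaT betaD lam tau eta m alpha))).
  have bz z : prod_norm (layer_comp L 0 m z - gamma_coef m alpha *: z) <=
      Num.sqrt (bbar_coef betaT betaD lam tau eta m alpha) * prod_norm z.
    apply: (layer_comp_le_bbar hilbX Tadj Dadj _ _ eigT eigD) => //.
    by move=> k' /andP[_ /e1].
  move=> /(_ bz); rewrite -thbarK /K eqxx delta0 deltam /gamma_coef.
  rewrite -scalerA -scalerBr prod_normZ ger0_norm ?exprn_ge0// => le.
  have p2 : 0 < 2 ^+ m :> R by rewrite exprn_gt0.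
  rewrite -(ler_pM2l p2) (le_trans le)// mulrA ler_wpM2r ?prod_norm_ge0//.
  (* As [K 0 m] is the square root of [abar 1 m], the chain bound reads sqrt(bbar) - sqrt(abar_1) +
     2 thetabar <= 2^m alpha, a rearrangement of the hypothesis. *)
  by move: Hmain; lra.
(* Since alpha > 0, the defining identity of averagedness forces this choice of [Q]. *)
exists (fun u => alpha^-1 *: (net u - (1 - alpha) *: u)); split=> [u w|u] /=.
  rewrite -scalerBr prod_normZ gtr0_norm ?invr_gt0//.
  rewrite ler_pdivrMl//.
  have -> : net u - (1 - alpha) *: u - (net w - (1 - alpha) *: w) =
      net u - net w - (1 - alpha) *: (u - w).
    by rewrite scalerBr !opprD !opprK addrACA.
  exact: net_contract.
by rewrite scalerA divff ?gt_eqF// scale1r addrC subrK.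
Qed.
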